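(* Let $H$ be a complex, separable, infinite-dimensional Hilbert space and let $\{f_n\}_{n\ge0}$ be an overcomplete Riesz frame for $H$. Then there do not exist a linear (not necessarily bounded) operator $T:\operatorname{span}\{f_n\}_{n\ge0}\to H$ and a vector $\varphi\in\operatorname{span}\{f_n\}_{n\ge 0}$ such that $f_n=T^n\varphi$ for all $n\ge0$.
   Context: A family $\{f_n\}_{n\in I}$ ($I$ countable) in $H$ is a frame for $H$ if there are constants $0<C_1\le C_2$ with $C_1\|f\|^2\le\sum_{n\in I}|\langle f,f_n\rangle|^2\le C_2\|f\|^2$ for all $f\in H$; it is a frame sequence if it is a frame for its closed linear span. A frame $\{f_n\}_{n\in I}$ is a Riesz frame if there are constants $0<C_1\le C_2$ such that for every $J\subset I$ the family $\{f_n\}_{n\in J}$ is a frame sequence with frame bounds $C_1,C_2$. A frame is overcomplete if it is not a Riesz basis. *)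

(* Defs.v *)
From HB Require Import structures.
From mathcomp Require Import all_boot all_order all_algebra.
From mathcomp Require Import sesquilinear.
From mathcomp Require Export complex.
From mathcomp Require Import boolp classical_sets functions cardinality.
From mathcomp Require Import reals ereal esum topology normedtype.

Set Implicit Arguments.
Unset Strict Implicit.
Unset Printing Implicit Defensive.

Import Order.TTheory GRing.Theory Num.Theory.
Import numFieldNormedType.Exports.

Local Open Scope classical_set_scope.
Local Open Scope complex_scope.
Local Open Scope ring_scope.

(* The library norm over R[i] takes values in R[i], on the nonnegative real
   axis; [rnorm x] is the same number in R. It serves both for the norm of a
   vector and for the modulus of a scalar. *)
Definition rnorm (R : realType) (V : normedZmodType R[i]) (x : V) : R :=
  complex.Re `|x|.

(* [dot] is linear in its first argument and conjugate-linear in the second.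
   A complex Hilbert space is a completeNormedModType over R[i] whose norm is
   induced by such a form. *)
Definition induces_norm (R : realType) (H : normedModType R[i])
    (dot : {dot H for (@Num.conj R[i])}) : Prop :=
  forall x : H, dot x x = `|x| ^+ 2.

Definition separable (T : topologicalType) : Prop :=
  exists2 D : set T, countable D & dense D.

(* Finite linear combinations of elements of A. *)
Definition lspan (K : pzRingType) (V : lmodType K) (A : set V) : set V :=
  [set x | exists (n : nat) (c : 'I_n -> K) (v : 'I_n -> V),
     (forall i, A (v i)) /\ x = \sum_(i < n) c i *: v i].

Definition infinite_dimensional (K : pzRingType) (V : lmodType K) : Prop :=
  ~ exists s : seq V, lspan [set` s] = [set: V].

(* Linearity of a map on a subspace D; the values of T outside D are
   irrelevant, so such a T stands for a linear operator D -> V. *)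
Definition linear_on (K : pzRingType) (V : lmodType K) (D : set V)
    (T : V -> V) : Prop :=
  forall (a : K) (x y : V), D x -> D y -> T (a *: x + y) = a *: T x + T y.

Section Frames.
Context (R : realType) (H : normedModType R[i]).
Context (dot : {dot H for (@Num.conj R[i])}) (I : countType).
Implicit Types (f : I -> H) (J : set I).

(* {f n}_(n in J) satisfies the frame inequalities on the subspace M with
   bounds C1 and C2. The sum of squares is taken in [0, +oo]. *)
Definition frame_bounds_on (M : set H) J f (C1 C2 : R) : Prop :=
  [/\ 0 < C1, C1 <= C2 &
    forall x : H, M x ->
      ((C1 * rnorm x ^+ 2)%:E
         <= \esum_(n in J) (rnorm (dot x (f n)) ^+ 2)%:E
         <= (C2 * rnorm x ^+ 2)%:E)%E].

Definition frame f : Prop :=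
  exists C1 C2, frame_bounds_on [set: H] [set: I] f C1 C2.

Definition frame_sequence_bounds J f (C1 C2 : R) : Prop :=
  frame_bounds_on (closure (lspan (f @` J))) J f C1 C2.

Definition riesz_frame f : Prop :=
  frame f /\ exists C1 C2, forall J, frame_sequence_bounds J f C1 C2.

(* A complete sequence whose synthesis map is bounded above and below on
   finitely supported scalar families. *)
Definition riesz_basis f : Prop :=
  closure (lspan (range f)) = [set: H] /\
  exists C1 C2 : R, [/\ 0 < C1, C1 <= C2 &
    forall (s : seq I) (c : I -> R[i]), uniq s ->
      C1 * (\sum_(n <- s) rnorm (c n) ^+ 2)
        <= rnorm (\sum_(n <- s) c n *: f n) ^+ 2
        <= C2 * (\sum_(n <- s) rnorm (c n) ^+ 2)].

Definition overcomplete f : Prop := frame f /\ ~ riesz_basis f.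

End Frames.

(* Main.v *)
Require Import Defs.
From mathcomp Require Import all_boot all_order all_algebra.
From mathcomp Require Import sesquilinear complex.
From mathcomp Require Import boolp classical_sets reals topology normedtype.
From mathcomp Require Import cardinality fsbigop ereal esum.
From mathcomp Require Import ring lra.

(** One linear dependence in an orbit f_n = T^n phi confines all of it: if
    f_N is a combination of independent vectors f_0, ..., f_(N-1), then their span
    is T-invariant and contains the whole orbit ([orbit_in_span]). A frame whose
    vectors all lie in the span of finitely many independent ones spans nothing
    more than that ([free_frame_spanning]), so H would be finite
    dimensional. Hence the f_n are linearly independent, and it remains to see
    that a linearly independent Riesz frame is a Riesz basis
    ([free_riesz_frame]), which contradicts overcompleteness.

    The heart of that last fact is the passage from a uniform lower frame bound
    on finite subfamilies to a uniform lower bound for the synthesis map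
    ([free_synthesis_lower]). For a finite independent family the Gram matrix is
    invertible, so every coefficient vector c is of the form
    c_n = <y, f_n> with y in the span ([free_dual_combination]). For
    x = \sum c_n f_n this gives <x, y> = |c|^2, while the frame bound gives
    C |y|^2 <= |c|^2; expanding 0 <= |x - C y|^2 yields C |c|^2 <= |x|^2. The
    constant C is the one of the Riesz frame and does not depend on the finite
    subfamily: this is where the Riesz property enters.

    A frame is complete ([frame_complete]) without any appeal to orthogonal
    projections: one truncated step x - C2^-1 \sum <x, f_n> f_n of the frame
    algorithm shrinks every vector by a fixed factor ([frame_contraction]), so
    the distance of x to the span must vanish. *)

Set Implicit Arguments.
Unset Strict Implicit.
Unset Printing Implicit Defensive.

Import Order.TTheory GRing.Theory Num.Theory.

Local Open Scope classical_set_scope.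
Local Open Scope complex_scope.
Local Open Scope ring_scope.

(** * Spans and linear maps on them *)

Section Span.
Context (K : pzRingType) (V : lmodType K).
Implicit Types (A : set V) (T : V -> V).

Lemma lspan0 A : lspan A 0.
Proof. by exists 0%N, (fun=> 0), (fun=> 0); split=> [[]//|]; rewrite big_ord0. Qed.

Lemma sub_lspan A : A `<=` lspan A.
Proof.
move=> x Ax; exists 1%N, (fun=> 1), (fun=> x).
by rewrite big_ord1 scale1r.
Qed.

Lemma lspan_linear A a x y : lspan A x -> lspan A y -> lspan A (a *: x + y).
Proof.
move=> [m [c [v [Av ->]]]] [n [d [w [Aw ->]]]].
exists (m + n)%N,
  (fun i => match fintype.split i with inl j => a * c j | inr k => d k end),
  (fun i => match fintype.split i with inl j => v j | inr k => w k end).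
split; first by move=> i; case: fintype.split.
rewrite big_split_ord /= scaler_sumr; congr (_ + _); apply: eq_bigr => i _.
  by rewrite (unsplitK (inl i : 'I_m + 'I_n)) scalerA.
by rewrite (unsplitK (inr i : 'I_m + 'I_n)).
Qed.

Lemma lspan_sum (I : Type) A (s : seq I) (c : I -> K) (v : I -> V) :
  (forall i, lspan A (v i)) -> lspan A (\sum_(i <- s) c i *: v i).
Proof.
move=> Av; elim: s => [|i s IHs]; first by rewrite big_nil; exact: lspan0.
by rewrite big_cons; exact: lspan_linear.
Qed.

Lemma lspan_sum_seq (I : eqType) (f : I -> V) (s : seq I) (c : I -> K) :
  lspan (f @` [set` s]) (\sum_(i <- s) c i *: f i).
Proof.
exists (size s), (fun i => c (tnth (in_tuple s) i)), (fun i => f (tnth (in_tuple s) i)).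
split; last by rewrite big_tnth.
by move=> i; exists (tnth (in_tuple s) i) => //=; rewrite mem_tnth.
Qed.

Lemma linear_on_sum (I : Type) A T (s : seq I) (c : I -> K) (v : I -> V) :
  linear_on (lspan A) T -> (forall i, lspan A (v i)) ->
  T (\sum_(i <- s) c i *: v i) = \sum_(i <- s) c i *: T (v i).
Proof.
move=> linT Av; elim: s => [|i s IHs]; last first.
  by rewrite !big_cons linT ?IHs//; exact: lspan_sum.
have := linT 1 0 0 (lspan0 A) (lspan0 A).
rewrite !big_nil !scale1r addr0 => T0.
by apply: (addrI (T 0)); rewrite -T0 addr0.
Qed.

End Span.

(** * Finite linear independence *)

Section Independence.
Context (K : pzRingType) (V : lmodType K) (I : eqType).
Implicit Types (f : I -> V) (s t : seq I).

(** Coefficients are indexed by [I] and not by positions in [s], as in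
    [riesz_basis]; this is linear independence only for duplicate-free [s]. *)
Definition free_on f s : Prop := forall c : I -> K,
  \sum_(n <- s) c n *: f n = 0 -> forall n, n \in s -> c n = 0.

(** A relation on [s], extended by zero, is a relation on [t]. *)
Lemma free_onS f s t : uniq s -> uniq t -> {subset s <= t} ->
  free_on f t -> free_on f s.
Proof.
move=> us ut st ft c c0 n ns.
have ct : \sum_(m <- t) (if m \in s then c m else 0) *: f m = 0.
  rewrite -[RHS]c0; transitivity (\sum_(m <- t | m \in s) c m *: f m).
    by rewrite [RHS]big_mkcond; apply: eq_bigr => m _; case: ifP; rewrite ?scale0r.
  rewrite -big_filter; apply: perm_big.
  apply: uniq_perm => //; first exact: filter_uniq.
  by move=> m; rewrite mem_filter; case: (boolP (m \in s)) => // /st.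
by have := ft _ ct n (st _ ns); rewrite ns.
Qed.

End Independence.

(** * Norm identities in an inner product space *)

Section InnerProduct.
Context (R : realType) (H : normedModType R[i]).
Context (dot : {dot H for (@Num.conj R[i])}) (hdot : induces_norm dot).
Implicit Types (x y : H).

Lemma rnormE (V : normedZmodType R[i]) (x : V) : (rnorm x)%:C = `|x|.
Proof. by rewrite /rnorm RRe_real// normr_real. Qed.

Lemma rnorm_ge0 (V : normedZmodType R[i]) (x : V) : 0 <= rnorm x.
Proof. by rewrite -ler0c rnormE. Qed.

Lemma rnorm_eq0 (V : normedZmodType R[i]) (x : V) : rnorm x = 0 -> x = 0.
Proof. by move=> x0; apply: normr0_eq0; rewrite -rnormE x0. Qed.

Lemma rnorm_sqr x : (rnorm x ^+ 2)%:C = dot x x.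
Proof. by rewrite hdot -rnormE rmorphXn. Qed.

Lemma rnorm_sqr_scalar (z : R[i]) : (rnorm z ^+ 2)%:C = z * Num.conj z.
Proof. by rewrite -normCK -rnormE rmorphXn. Qed.

Lemma dotC x y : dot x y = Num.conj (dot y x).
Proof. by rewrite hermC mul1r. Qed.

Lemma conj_real_complex (r : R) : Num.conj r%:C = r%:C :> R[i].
Proof. by apply/CrealP; rewrite complex_real. Qed.

(** The real form of the expansion of |x - l y|^2. Choosing [y] so that <x, y>
    is an explicit real number lets this one identity replace the
    Cauchy-Schwarz inequality below. *)
Lemma rnorm_sqrB x y b l : dot x y = b%:C ->
  rnorm (x - l%:C *: y) ^+ 2
    = rnorm x ^+ 2 - 2 * l * b + l ^+ 2 * rnorm y ^+ 2.
Proof.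
move=> xy; apply: complexI; rewrite rnorm_sqr dnormB.
rewrite linearZl_LR linearZr_LR linearZr_LR /= xy rmorphM /= !conj_real_complex.
by rewrite -!rnorm_sqr !(rmorphD, rmorphN, rmorphM, rmorphXn) /=; ring.
Qed.

Lemma dot_suml (I : Type) (s : seq I) (c : I -> R[i]) (f : I -> H) y :
  dot (\sum_(n <- s) c n *: f n) y = \sum_(n <- s) c n * dot (f n) y.
Proof. by rewrite linear_sumlz; apply: eq_bigr => n _; rewrite linearZl_LR. Qed.

(** * Synthesis bounds for finite families *)

Section Family.
Context (I : eqType) (f : I -> H) (s : seq I).

(** The coefficients [a] solve a linear system whose matrix is the Gram matrix
    of the family. A vector in its kernel gives a combination of the family that
    is orthogonal to each of its members, hence to itself, hence is zero. *)
Lemma free_dual_combination : uniq s -> free_on f s ->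
  forall c : I -> R[i], exists a : I -> R[i],
    forall m, m \in s -> dot (\sum_(n <- s) a n *: f n) (f m) = c m.
Proof.
move=> us fs c; pose t i := tnth (in_tuple s) i.
pose ext (v : 'rV[R[i]]_(size s)) m := if insub (index m s) is Some i then v 0 i else 0.
have extE v i : ext v (t i) = v 0 i.
  by rewrite /ext /t (tnth_nth (t i)) index_uniq// valK.
pose G := \matrix_(i, j) dot (f (t i)) (f (t j)).
have mulG v j : (v *m G) 0 j = dot (\sum_(m <- s) ext v m *: f m) (f (t j)).
  rewrite mxE dot_suml [RHS]big_tnth; apply: eq_bigr => i _.
  by rewrite mxE extE.
have Gu : G \in unitmx.
  rewrite -row_free_unit -kermx_eq0; apply/eqP/row_matrixP => k.
  rewrite row0; move: (row_sub k (kermx G)); move: (row k _) => v /sub_kermxP vG0.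
  have x0 : \sum_(m <- s) ext v m *: f m = 0.
    apply/eqP; rewrite -(dnorm_eq0 dot) linear_sumr big1_seq//= => m ms.
    rewrite linearZr_LR /=; have [i ->] : exists i, m = t i.
      by have /tnthP[i ->] : m \in in_tuple s by []; exists i.
    by rewrite -mulG vG0 mxE mulr0.
  apply/rowP => i; rewrite -extE mxE; apply: (fs _ x0).
  exact: (mem_tnth i (in_tuple s)).
exists (ext ((\row_i c (t i)) *m invmx G)) => m ms.
have /tnthP[i mi] : m \in in_tuple s by [].
by rewrite mi -/(t i) -mulG mulmxKV// mxE.
Qed.

(** The optimal lower bounds of the analysis and synthesis maps of an
    independent finite family agree: they are the least eigenvalues of the frame
    operator on the span and of the Gram matrix, U U* and U* U. The dual
    combination makes the comparison without spectral theory. *)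
Lemma free_synthesis_lower (C : R) : uniq s -> free_on f s -> 0 < C ->
  (forall y, lspan (f @` [set` s]) y ->
     C * rnorm y ^+ 2 <= \sum_(n <- s) rnorm (dot y (f n)) ^+ 2) ->
  forall c : I -> R[i],
    C * (\sum_(n <- s) rnorm (c n) ^+ 2) <= rnorm (\sum_(n <- s) c n *: f n) ^+ 2.
Proof.
move=> us fs C0 lowC c; have [a ac] := free_dual_combination us fs c.
set x := \sum_(n <- s) c n *: f n; set b := \sum_(n <- s) _.
pose y := \sum_(n <- s) a n *: f n.
have xy : dot x y = b%:C.
  rewrite dot_suml rmorph_sum /=; apply: eq_big_seq => n ns.
  by rewrite dotC /y ac// -rnorm_sqr_scalar.
have yb : C * rnorm y ^+ 2 <= b.
  have <- : \sum_(n <- s) rnorm (dot y (f n)) ^+ 2 = b.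
    by apply: eq_big_seq => n ns; rewrite /y ac.
  exact: lowC (lspan_sum_seq _ _ _).
have := sqr_ge0 (rnorm (x - C%:C *: y)); rewrite (rnorm_sqrB _ xy).
by have := ler_wpM2l (ltW C0) yb; lra.
Qed.

(** The analysis and synthesis maps are adjoint, hence have the same norm. Here
    the inequality comes from the expansion of the nonnegative sum of the
    |C c_n - <x, f_n>|^2, with x the synthesized vector. *)
Lemma synthesis_upper (C : R) : 0 < C ->
  (forall y, lspan (f @` [set` s]) y ->
     \sum_(n <- s) rnorm (dot y (f n)) ^+ 2 <= C * rnorm y ^+ 2) ->
  forall c : I -> R[i],
    rnorm (\sum_(n <- s) c n *: f n) ^+ 2 <= C * (\sum_(n <- s) rnorm (c n) ^+ 2).
Proof.
move=> C0 uppC c; have := uppC _ (lspan_sum_seq f s c).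
set x := \sum_(n <- s) c n *: f n; set b := \sum_(n <- s) rnorm (c n) ^+ 2.
set e := \sum_(n <- s) _ => ex.
have xx : \sum_(n <- s) c n * Num.conj (dot x (f n)) = (rnorm x ^+ 2)%:C.
  by rewrite rnorm_sqr {2}/x dot_suml; apply: eq_bigr => n _; rewrite -dotC.
suff : 0 <= C ^+ 2 * b - 2 * C * rnorm x ^+ 2 + e.
  have := sqr_ge0 (rnorm x); nra.
have -> : C ^+ 2 * b - 2 * C * rnorm x ^+ 2 + e
    = \sum_(n <- s) rnorm (C%:C * c n - dot x (f n)) ^+ 2.
  apply: complexI.
  have xx' : \sum_(n <- s) Num.conj (c n) * dot x (f n) = (rnorm x ^+ 2)%:C.
    rewrite -conj_real_complex -xx rmorph_sum; apply: eq_bigr => n _.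
    by rewrite rmorphM /= conjCK.
  transitivity (C%:C ^+ 2 * b%:C
      - C%:C * (\sum_(n <- s) c n * Num.conj (dot x (f n)))
      - C%:C * (\sum_(n <- s) Num.conj (c n) * dot x (f n)) + e%:C).
    by rewrite xx xx' !(rmorphD, rmorphN, rmorphM, rmorphXn) /=; ring.
  rewrite !rmorph_sum /= !mulr_sumr -!sumrB -big_split /=; apply: eq_bigr => n _.
  rewrite !rnorm_sqr_scalar rmorphB rmorphM /= conj_real_complex; ring.
by apply: sumr_ge0 => n _; exact: sqr_ge0.
Qed.

End Family.

(** * Frames and Riesz frames *)

Section Frame.
Context (I : countType) (f : I -> H).

Lemma esum_seq (s : seq I) (u : I -> R) : uniq s -> (forall n, 0 <= u n) ->
  \esum_(n in [set` s]) (u n)%:E = (\sum_(n <- s) u n)%:E.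
Proof.
move=> us u0; rewrite esum_fset; last 2 first.
- exact: finite_seq.
- by move=> n _; rewrite lee_fin.
by rewrite -fsbig_seq// sumEFin.
Qed.

Lemma esum_gt_seq (u : I -> R) (a : R) : (forall n, 0 <= u n) ->
  (a%:E < \esum_(n in [set: I]) (u n)%:E)%E ->
  exists2 s : seq I, uniq s & a < \sum_(n <- s) u n.
Proof.
move=> u0 /ereal_sup_gt[_ [A [finA _] <-] aA].
have [s As] := (finite_seqP A).1 finA.
exists (undup s); first exact: undup_uniq.
rewrite -lte_fin -sumEFin fsbig_seq ?undup_uniq//.
rewrite (_ : [set` undup s] = A)//.
by rewrite As; apply/seteqP; split=> n /=; rewrite mem_undup.
Qed.

Lemma bessel_seq (M : set H) (J : set I) (C1 C2 : R) (s : seq I) x :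
  frame_bounds_on dot M J f C1 C2 -> M x -> uniq s -> [set` s] `<=` J ->
  \sum_(n <- s) rnorm (dot x (f n)) ^+ 2 <= C2 * rnorm x ^+ 2.
Proof.
move=> [_ _ fb] /fb /andP[_ xC2] us sJ.
rewrite -lee_fin; apply: le_trans xC2; rewrite -esum_seq//; last first.
  by move=> n; exact: sqr_ge0.
apply: esum_ge; exists [set` s]; first by split=> //; exact: finite_seq.
rewrite -fsbig_seq// sumEFin esum_seq// => n; exact: sqr_ge0.
Qed.

(** With y = \sum <x, f_n> f_n over a finite set of indices and b the sum of the
    |<x, f_n>|^2 over it, <x, y> = b and |y|^2 <= C2 b, so
    |x - C2^-1 y|^2 <= |x|^2 - C2^-1 b. A large enough finite set has
    b > C1/2 |x|^2. *)
Lemma frame_contraction (C1 C2 : R) x : frame_bounds_on dot setT setT f C1 C2 ->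
  exists2 y, lspan (range f) y &
    rnorm (x - y) ^+ 2 <= (1 - C1 / (2 * C2)) * rnorm x ^+ 2.
Proof.
move=> fb; have [C10 C12 fC] := fb; have C20 : 0 < C2 := lt_le_trans C10 C12.
have [x0|xn0] := eqVneq (rnorm x) 0.
  exists 0; first exact: lspan0.
  by rewrite subr0 x0 expr0n mulr0.
have xp : 0 < rnorm x ^+ 2 by rewrite exprn_gt0// lt_def xn0 rnorm_ge0.
have [|s us xs] := @esum_gt_seq (fun n => rnorm (dot x (f n)) ^+ 2)
    (C1 / 2 * rnorm x ^+ 2) (fun n => sqr_ge0 _).
  have /andP[+ _] := fC x Logic.I; apply: lt_le_trans.
  by rewrite lte_fin; nra.
pose y := \sum_(n <- s) dot x (f n) *: f n.
set b := \sum_(n <- s) _ in xs.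
have yb : rnorm y ^+ 2 <= C2 * b.
  apply: synthesis_upper => // z _; exact: bessel_seq fb _ us _.
have xy : dot x y = b%:C.
  rewrite dotC dot_suml !rmorph_sum /=; apply: eq_bigr => n _.
  by rewrite rnorm_sqr_scalar (dotC (f n) x) rmorphM /= conjCK mulrC.
exists (C2^-1%:C *: y).
  rewrite -[_ *: y]addr0; apply: lspan_linear (lspan0 _).
  by apply: lspan_sum => n; apply: sub_lspan; exists n.
rewrite (rnorm_sqrB _ xy).
have -> : C1 / (2 * C2) = C2^-1 * (C1 / 2) by rewrite invfM; ring.
have k0 : 0 < C2^-1 by rewrite invr_gt0.
have kC : C2^-1 * C2 = 1 by rewrite mulVf// gt_eqF.
have : C2^-1 ^+ 2 * rnorm y ^+ 2 <= C2^-1 * b.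
  have := ler_wpM2l (sqr_ge0 C2^-1) yb.
  suff -> : C2^-1 ^+ 2 * (C2 * b) = C2^-1 * b by [].
  by rewrite expr2 -mulrA (mulrA _ C2) kC mul1r.
nra.
Qed.

(** The contraction, applied to x - y for y in the span, bounds the squared
    distance d of x to the span by a factor q < 1 times any |x - y|^2; hence
    d <= q d and d = 0. *)
Lemma frame_complete : frame dot f -> closure (lspan (range f)) = setT.
Proof.
move=> [C1 [C2 fb]]; apply/seteqP; split=> // x _.
have [C10 C12 fC] := fb; have C20 : 0 < C2 := lt_le_trans C10 C12.
pose q := 1 - C1 / (2 * C2).
have q1 : q < 1 by rewrite ltrBlDr ltrDl divr_gt0// mulr_gt0.
pose E : set R := [set rnorm (x - y) ^+ 2 | y in lspan (range f)].
have E0 : E !=set0 by exists (rnorm (x - 0) ^+ 2); exists 0 => //; exact: lspan0.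
have lbE : lbound E 0 by move=> _ [y _ <-]; exact: sqr_ge0.
have hE : has_inf E by split=> //; exists 0.
have d0 : 0 <= inf E by exact: lb_le_inf.
have dq r : E r -> inf E <= q * r.
  move=> [y yf <-]; have [z zf xyz] := frame_contraction (x - y) fb.
  apply: le_trans xyz; apply: ge_inf; first by exists 0.
  exists (y + z); last by rewrite opprD addrA.
  by rewrite -[y]scale1r; exact: lspan_linear.
have d_eq0 : inf E = 0.
  apply/eqP; rewrite eq_le d0 andbT leNgt; apply/negP => dp.
  (* An element r < (2 - q) d of E would give d <= q r < q (2 - q) d < d. *)
  have : 0 < (1 - q) * inf E by rewrite mulr_gt0// subr_gt0.
  move=> /inf_adherent /(_ hE)[r Er].
  have := dq _ Er; have : inf E <= r by apply: ge_inf => //; exists 0.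
  nra.
move=> B /nbhs_ballP[e /= e0 eB].
(* The radius e is a scalar of the complex field, positive hence real. *)
have re : e = (complex.Re e)%:C by rewrite RRe_real// ger0_real// ltW.
have r0 : 0 < complex.Re e by move: e0; rewrite re ltcR.
have : 0 < complex.Re e ^+ 2 by rewrite exprn_gt0.
move=> /inf_adherent /(_ hE)[_ [y yf <-]]; rewrite d_eq0 add0r => xy.
exists y; split=> //; apply: eB; rewrite -ball_normE /= -rnormE re ltcR.
by move: xy; rewrite ltr_pXn2r// nnegrE ?rnorm_ge0 ?ltW.
Qed.

(** Since the Gram system of [s] can be solved, every vector has an orthogonal
    projection y on the span of [s]. Then x - y is orthogonal to the whole
    frame, and the lower frame bound forces x = y. *)
Lemma free_frame_spanning (s : seq I) : frame dot f -> uniq s -> free_on f s ->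
  (forall n, lspan (f @` [set` s]) (f n)) ->
  lspan (f @` [set` s]) = setT.
Proof.
move=> [C1 [C2 [C10 _ fC]]] us fs fspan; apply/seteqP; split=> // x _.
have [a xa] := free_dual_combination us fs (fun m => dot x (f m)).
set y := \sum_(n <- s) a n *: f n in xa.
suff -> : x = y by exact: lspan_sum_seq.
have xyf n : dot (x - y) (f n) = 0.
  have [m [c [v [vs ->]]]] := fspan n.
  rewrite linear_sumr big1// => i _; rewrite linearZr_LR /=.
  have [k ks <-] := vs i.
  by rewrite linearBl /= xa// subrr mulr0.
have /andP[+ _] := fC (x - y) Logic.I.
rewrite esum1 => [|n _]; last by rewrite xyf /rnorm normr0 expr0n.
rewrite lee_fin => xy0; apply/eqP; rewrite -subr_eq0; apply/eqP/rnorm_eq0.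
apply/eqP; rewrite -sqrf_eq0 eq_le sqr_ge0 andbT; nra.
Qed.

(** The frame inequalities for a finite index set are known only on the span of
    the corresponding vectors; this is the only place where the two synthesis
    lemmas test them, so the constants of the Riesz frame become Riesz bounds. *)
Lemma free_riesz_frame : riesz_frame dot f ->
  (forall s : seq I, uniq s -> free_on f s) -> riesz_basis f.
Proof.
move=> [frf [C1 [C2 rf]]] ff; split; first exact: frame_complete.
have [C10 C12 _] := rf setT; exists C1, C2; split=> // s c us.
have spanJ y : lspan (f @` [set` s]) y -> closure (lspan (f @` [set` s])) y.
  exact: subset_closure.
apply/andP; split.
  apply: free_synthesis_lower => // [|y ys]; first exact: ff.
  have [_ _ /(_ y (spanJ _ ys))/andP[+ _]] := rf [set` s].
  by rewrite esum_seq// => n; exact: sqr_ge0.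
apply: synthesis_upper => [|y ys]; first exact: lt_le_trans C10 C12.
by apply: bessel_seq (rf [set` s]) _ us _ => //; exact: spanJ.
Qed.

End Frame.

End InnerProduct.

(** * Orbits of linear operators *)

(** T maps f_k to f_(k+1), so the span of f_0, ..., f_(N-1) is T-invariant as
    soon as it contains f_N. *)
Lemma orbit_in_span (K : pzRingType) (V : lmodType K) (T : V -> V) (f : nat -> V)
    (N : nat) :
  linear_on (lspan (range f)) T -> (forall n, f n.+1 = T (f n)) ->
  lspan (f @` [set` iota 0 N]) (f N) ->
  forall n, lspan (f @` [set` iota 0 N]) (f n).
Proof.
move=> linT fS fN; elim=> [|n [m [c [v [vN fn]]]]].
  case: N fN => // N _; apply: sub_lspan; exists 0%N => //=; rewrite mem_iota //.
have Df k : lspan (range f) (f k) by apply: sub_lspan; exists k.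
rewrite fS fn (linear_on_sum _ _ linT) => [|i]; last first.
  by have [k _ <-] := vN i.
apply: lspan_sum => i; have [k /= + <-] := vN i.
rewrite mem_iota /= add0n -fS leq_eqVlt => /orP[/eqP -> //|kN].
by apply: sub_lspan; exists k.+1; rewrite //= mem_iota.
Qed.

(** In a nontrivial relation among f_0, ..., f_N the coefficient of f_N cannot
    vanish, since the preceding vectors are independent. *)
Lemma dependent_prefix (K : fieldType) (V : lmodType K) (f : nat -> V) (N : nat) :
  free_on f (iota 0 N) -> ~ free_on f (iota 0 N.+1) ->
  lspan (f @` [set` iota 0 N]) (f N).
Proof.
move=> fN; apply: contra_notP => nspan c c0 n.
have iotaS : iota 0 N.+1 = rcons (iota 0 N) N by rewrite -addn1 iotaD cats1.
move: c0; rewrite iotaS mem_rcons inE -cats1 big_cat big_seq1 /= => c0.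
have [cN|cN] := eqVneq (c N) 0.
  move=> /orP[/eqP -> //|]; apply: fN.
  by rewrite cN scale0r addr0 in c0.
case: nspan; move/eqP: c0; rewrite addrC addr_eq0 => /eqP c0.
rewrite -[f N](scalerK cN) c0 -scaleN1r scalerA scaler_sumr.
under eq_bigr do rewrite scalerA.
exact: lspan_sum_seq.
Qed.

Theorem theorem29 (R : realType) (H : completeNormedModType R[i])
    (dot : {dot H for (@Num.conj R[i])}) (hdot : induces_norm dot)
    (hsep : separable H) (hinf : infinite_dimensional H)
    (f : nat -> H) (hriesz : riesz_frame dot f) (hover : overcomplete dot f) :
  ~ exists (T : H -> H) (phi : H),
      [/\ linear_on (lspan (range f)) T,
          lspan (range f) phi
        & forall n : nat, f n = iter n T phi].
Proof.
move=> [T [phi [linT _ fT]]].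
have fS n : f n.+1 = T (f n) by rewrite !fT.
have [frf nbasis] := hover.
have free_prefix N : free_on f (iota 0 N).
  elim: N => [//|N fN]; apply: contrapT => nfN; apply: hinf.
  have fspan := orbit_in_span linT fS (dependent_prefix fN nfN).
  exists [seq f k | k <- iota 0 N].
  rewrite -(free_frame_spanning frf (iota_uniq 0 N) fN fspan).
  congr (lspan _); apply/seteqP; split=> x /=.
    by move=> /mapP[k kN ->]; exists k.
  by move=> [k kN <-]; exact: map_f.
apply: nbasis; apply: (free_riesz_frame hdot hriesz) => s us.
apply: free_onS us (iota_uniq 0 (\max_(n <- s) n).+1) _ (free_prefix _) => n ns.
by rewrite mem_iota /= add0n ltnS; exact: leq_bigmax_seq.
Qed.
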